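(* Let $\{\phi_k\}_{k=0}^{\infty}$ be a complete orthonormal basis (real- or complex-valued) for functions on $[0,1]$ with $\phi_0=\frac{1}{\|1\|}$ (the constant function). Assume that the joint probability density function $f(x,y)$ of two random variables $X$ and $Y$ with values in $[0,1]$ has the expansion $f(x,y)=\sum_{j,k=0}^{\infty} c_{j,k}\,\phi_j(x)\phi_k(y)$, and that the marginal distribution of $Y$ is the uniform distribution $U[0,1]$. Then $X$ and $Y$ are independent if and only if the expansion coefficient matrix $C=[c_{j,k}]_{j,k\ge 0}$ is a rank-1 matrix of the form $C=[h_0,h_1,h_2,\dots]^T[1,0,0,\dots]$. Equivalently, $X$ and $Y$ are independent if and only if the expansion coefficients satisfy $c_{j,k}=0$ for all $j$ and any $k\neq 0$.
   Context: Orthonormality is with respect to $\langle u,v\rangle=\int_0^1 u(x)\overline{v(x)}\,dx$, and $\|\cdot\|$ is the associated norm, so $\phi_0\equiv 1$ on $[0,1]$. The same one-dimensional basis is used for both variables, and the $h_j$ are scalars (real or complex, according to the basis). Examples of admissible bases, suitably scaled and indexed for $[0,1]$, are the normalized Legendre polynomials, the complex Fourier basis, the Walsh functions and the Haar wavelets. *)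

(* Defs.v *)
(* MathComp-Analysis, over an arbitrary [R : realType]. *)
From HB Require Import structures.
From mathcomp Require Import all_boot all_order all_algebra.
From mathcomp Require Import all_classical all_reals all_analysis.
From mathcomp Require Import complex.

Set Implicit Arguments.
Unset Strict Implicit.
Unset Printing Implicit Defensive.

Import Order.TTheory GRing.Theory Num.Theory.
Import numFieldNormedType.Exports.

Local Open Scope classical_set_scope.
Local Open Scope ring_scope.
Local Open Scope complex_scope.

(* A basis may be real- or complex-valued.  Both cases live in [R[i]]; the real
   case restricts the basis, the functions it has to represent, and all the
   coefficients, to real values. *)
Variant scalar_kind := RealScalars | ComplexScalars.

Definition scalars (R : realType) (K : scalar_kind) : set R[i] :=
  match K with
  | RealScalars => [set z | complex.Im z = 0]
  | ComplexScalars => setT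
  end.
Arguments scalars : clear implicits.

Definition unit_interval (R : realType) : set R := `[0, 1]%classic.
Arguments unit_interval : clear implicits.

Definition unit_square (R : realType) : set (R * R) :=
  unit_interval R `*` unit_interval R.
Arguments unit_square : clear implicits.

Section complex_L2.
Context {d : measure_display} {T : measurableType d} {R : realType}.
Variables (mu : {measure set T -> \bar R}) (D : set T).

(* Both [Rintegral]s are meaningful when [u] is integrable on [D], which is
   the case for the products of square-integrable functions used below. *)
Definition cintegral (u : T -> R[i]) : R[i] :=
  (\int[mu]_(x in D) complex.Re (u x)) +i* (\int[mu]_(x in D) complex.Im (u x)).

Definition inner (u v : T -> R[i]) : R[i] :=
  cintegral (fun x => u x * (v x)^*).

(* Extended-real valued, so that it is +oo, and not a junk value, on functions
   that are not square-integrable.  [`|u x|] is an element of [R[i]] with zero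
   imaginary part. *)
Definition L2norm (u : T -> R[i]) : \bar R :=
  ('N[mu]_2%:E[(fun x => (complex.Re `|u x|)%:E) \_ D])%E.

Definition in_L2 (K : scalar_kind) (u : T -> R[i]) : Prop :=
  [/\ forall x, D x -> scalars R K (u x),
      measurable_fun D (fun x => complex.Re (u x)),
      measurable_fun D (fun x => complex.Im (u x)) &
      (L2norm u < +oo)%E].

Definition orthonormal_family (phi : nat -> T -> R[i]) : Prop :=
  forall j k, inner (phi j) (phi k) = (j == k)%:R.

Definition complete_orthonormal_basis (K : scalar_kind)
    (phi : nat -> T -> R[i]) : Prop :=
  [/\ forall k, in_L2 K (phi k),
      orthonormal_family phi &
      forall u, in_L2 K u ->
        L2norm (fun x => u x - \sum_(k < n) inner u (phi k) * phi k x)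
          @[n --> \oo] --> 0%E].

End complex_L2.

(* f(x,y) = sum_{j,k} c_{j,k} phi_j(x) phi_k(y), the double series converging in
   mean square on the unit square: the limit is over the rectangular partial
   sums, as both cut-offs tend to infinity independently. *)
Definition has_expansion (R : realType) (f : R * R -> R)
    (c : nat -> nat -> R[i]) (phi : nat -> R -> R[i]) : Prop :=
  L2norm (lebesgue_measure \x lebesgue_measure)%E (unit_square R)
    (fun z => (f z)%:C -
       \sum_(j < N.1) \sum_(k < N.2) c j k * (phi j z.1 * phi k z.2))
    @[N --> filter_prod \oo \oo] --> 0%E.

Section random_pair.
Context {d : measure_display} {T : measurableType d} {R : realType}.
Variables (P : probability T R) (X Y : {RV P >-> R}).

Definition independent_RV : Prop :=
  forall A B : set R, measurable A -> measurable B ->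
    P (X @^-1` A `&` Y @^-1` B) = (P (X @^-1` A) * P (Y @^-1` B))%E.

Definition joint_density (f : R * R -> R) : Prop :=
  [/\ measurable_fun (unit_square R) f,
      forall z, unit_square R z -> 0 <= f z &
      forall A : set (R * R), measurable A ->
        P [set w | A (X w, Y w)] =
        (\int[lebesgue_measure \x lebesgue_measure]_(z in A `&` unit_square R)
           (f z)%:E)%E].

Definition uniform01 : Prop :=
  forall A : set R, measurable A ->
    distribution P Y A = uniform_prob (@ltr01 R) A.

End random_pair.

Section infinite_matrix.
Context {F : fieldType}.

Definition outer (h g : nat -> F) : nat -> nat -> F := fun j k => h j * g k.

Definition first_unit_vector : nat -> F := fun k => (k == 0%N)%:R.

(* The column space of [C] has dimension [r]: some [r] columns form a basis. *)
Definition has_rank (C : nat -> nat -> F) (r : nat) : Prop :=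
  exists s : 'I_r -> nat,
    (forall a : 'I_r -> F,
       (forall j, \sum_(i < r) a i * C j (s i) = 0) -> forall i, a i = 0) /\
    (forall k, exists a : 'I_r -> F,
       forall j, C j k = \sum_(i < r) a i * C j (s i)).

End infinite_matrix.

(* Main.v *)
(** Write [<u>] for the integral of [u], and [a (x) b] for [a(x) b(y)].  Mean
    square convergence and the Cauchy-Schwarz inequality give
    [<f (a (x) b)> = lim sum c_jk <phi_j a> <phi_k b>] for all square-integrable
    [a] and [b], so that [c_pq = <f (conj phi_p (x) conj phi_q)>].  Since [Y] is
    uniform, independence says that
    [int_{A x B} f = |B| int_{A x [0,1]} f] for all [A, B] included in [[0,1]].

    If [c_jk = 0] for [k != 0], apply the formula to [a = 1_A] and
    [b = 1_B - |B|]: all terms vanish, because [phi_0 = 1] and [<b> = 0].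
    Conversely, under independence, for [A] fixed the function
    [y |-> int_A f(x,y) dx] is almost everywhere equal to the constant
    [int_{A x [0,1]} f], hence is orthogonal to every [b] with [<b> = 0], in
    particular to [conj phi_q] for [q != 0].  Thus the function
    [x |-> <f(x,.) b>] has integral 0 on every [A] and is itself almost
    everywhere 0, so that [c_pq = 0].  The rank is 1 and not 0 because
    [c_00 = <f> = 1]. *)

Require Import Defs.
From HB Require Import structures.
From mathcomp Require Import all_boot all_order all_algebra.
From mathcomp Require Import all_classical all_reals all_analysis.
From mathcomp Require Import measurable_realfun complex ring.

Set Implicit Arguments.
Unset Strict Implicit.
Unset Printing Implicit Defensive.

Import Order.TTheory GRing.Theory Num.Theory.
Import numFieldNormedType.Exports.

Local Open Scope classical_set_scope.
Local Open Scope ring_scope.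
Local Open Scope complex_scope.

(** * Real part, imaginary part and modulus of complex numbers *)

Section complex_parts.
Context {R : realType}.
Implicit Types z w : R[i].
Local Notation Re := (@complex.Re R).
Local Notation Im := (@complex.Im R).

Lemma complexP z w : Re z = Re w -> Im z = Im w -> z = w.
Proof. by case: z w => [a b] [c d] /= -> ->. Qed.

Lemma ReD z w : Re (z + w) = Re z + Re w.
Proof. by case: z w => [a b] [c d]. Qed.

Lemma ImD z w : Im (z + w) = Im z + Im w.
Proof. by case: z w => [a b] [c d]. Qed.

Lemma ReM z w : Re (z * w) = Re z * Re w - Im z * Im w.
Proof. by case: z w => [a b] [c d]. Qed.

Lemma ImM z w : Im (z * w) = Re z * Im w + Im z * Re w.
Proof. by case: z w => [a b] [c d]. Qed.

Lemma ReJ z : Re z^* = Re z. Proof. by case: z. Qed.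

Lemma ImJ z : Im z^* = - Im z. Proof. by case: z. Qed.

(** The modulus is an element of [R[i]]; its real part is the modulus as a real number. *)
Lemma Re_normcE z : Re `|z| = Num.sqrt (Re z ^+ 2 + Im z ^+ 2).
Proof. by rewrite normc_def. Qed.

Lemma Re_normc_ge0 z : 0 <= Re `|z|.
Proof. by rewrite Re_normcE sqrtr_ge0. Qed.

Lemma Re_normc_sqr z : Re `|z| ^+ 2 = Re z ^+ 2 + Im z ^+ 2.
Proof. by rewrite Re_normcE sqr_sqrtr// addr_ge0// sqr_ge0. Qed.

Lemma Re_normcM z w : Re `|z * w| = Re `|z| * Re `|w|.
Proof. by rewrite normrM [`|z|]normc_def [`|w|]normc_def -rmorphM. Qed.

Lemma normr_Re_le z : `|Re z| <= Re `|z|.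
Proof. by have := normc_ge_Re z; rewrite lecE => /andP[_]. Qed.

Lemma normr_Im_le z : `|Im z| <= Re `|z|.
Proof.
by rewrite Re_normcE -[leLHS]sqrtr_sqr ler_wsqrtr// lerDr sqr_ge0.
Qed.

End complex_parts.

(** * Measurability and integration of complex-valued functions *)

Section complex_integral.
Context {d : measure_display} {T : measurableType d} {R : realType}.
Variables (mu : {measure set T -> \bar R}) (D : set T).
Hypothesis mD : measurable D.
Implicit Types u v e : T -> R[i].
Local Notation Re := (@complex.Re R).
Local Notation Im := (@complex.Im R).

(** Componentwise, to match the definition of [cintegral]. *)
Definition cmeasurable u :=
  measurable_fun D (fun x => Re (u x)) /\ measurable_fun D (fun x => Im (u x)).

Definition cintegrable u :=
  mu.-integrable D (fun x => (Re (u x))%:E) /\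
  mu.-integrable D (fun x => (Im (u x))%:E).

Lemma cmeasurableD u v : cmeasurable u -> cmeasurable v ->
  cmeasurable (fun x => u x + v x).
Proof.
move=> [ru iu] [rv iv]; split.
- by under eq_fun do rewrite ReD; exact: measurable_funD.
- by under eq_fun do rewrite ImD; exact: measurable_funD.
Qed.

Lemma cmeasurableM u v : cmeasurable u -> cmeasurable v ->
  cmeasurable (fun x => u x * v x).
Proof.
move=> [ru iu] [rv iv]; split.
- under eq_fun do rewrite ReM.
  by apply: measurable_funB; exact: measurable_funM.
- under eq_fun do rewrite ImM.
  by apply: measurable_funD; exact: measurable_funM.
Qed.

Lemma cmeasurable_cst (z : R[i]) : cmeasurable (fun=> z).
Proof. by split; exact: measurable_cst. Qed.

Lemma cmeasurableN u : cmeasurable u -> cmeasurable (fun x => - u x).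
Proof.
move=> mu_; under eq_fun do rewrite -mulN1r.
exact: cmeasurableM (cmeasurable_cst _) mu_.
Qed.

Lemma cmeasurable_sum n (u : 'I_n -> T -> R[i]) :
  (forall i, cmeasurable (u i)) -> cmeasurable (fun x => \sum_(i < n) u i x).
Proof.
move=> mu_; elim: n => [|n IH] in u mu_ *.
  by under eq_fun do rewrite big_ord0; exact: cmeasurable_cst.
under eq_fun do rewrite big_ord_recl.
by apply: cmeasurableD; [exact: mu_|exact: IH].
Qed.

Lemma eq_cintegral u v : (forall x, D x -> u x = v x) ->
  cintegral mu D u = cintegral mu D v.
Proof.
by move=> uv; congr Complex; apply: eq_Rintegral => x /set_mem /uv ->.
Qed.

Lemma eq_cintegrable u v : (forall x, D x -> u x = v x) ->
  cintegrable u -> cintegrable v.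
Proof.
move=> uv [ru iu]; split; [move: ru|move: iu];
  by apply: eq_integrable => // x /set_mem /uv ->.
Qed.

Lemma cintegrableD u v : cintegrable u -> cintegrable v ->
  cintegrable (fun x => u x + v x).
Proof.
move=> [ru iu] [rv iv]; split.
- by under eq_fun do rewrite ReD EFinD; exact: integrableD.
- by under eq_fun do rewrite ImD EFinD; exact: integrableD.
Qed.

Lemma cintegralD u v : cintegrable u -> cintegrable v ->
  cintegral mu D (fun x => u x + v x) = cintegral mu D u + cintegral mu D v.
Proof.
move=> [ru iu] [rv iv]; apply: complexP; rewrite ?ReD ?ImD /=.
- by under eq_Rintegral do rewrite ReD; exact: RintegralD.
- by under eq_Rintegral do rewrite ImD; exact: RintegralD.
Qed.

Let integrableZ (a : R) (g : T -> R) : mu.-integrable D (EFin \o g) ->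
  mu.-integrable D (fun x => (a * g x)%:E).
Proof. by move=> ig; under eq_fun do rewrite EFinM; exact: integrableZl. Qed.

Lemma cintegrableZl (a : R[i]) u : cintegrable u ->
  cintegrable (fun x => a * u x).
Proof.
move=> [ru iu]; split.
- under eq_fun do rewrite ReM EFinB.
  by apply: integrableB => //; exact: integrableZ.
- under eq_fun do rewrite ImM EFinD.
  by apply: integrableD => //; exact: integrableZ.
Qed.

Lemma cintegralZl (a : R[i]) u : cintegrable u ->
  cintegral mu D (fun x => a * u x) = a * cintegral mu D u.
Proof.
move=> [ru iu]; apply: complexP; rewrite ?ReM ?ImM /=.
- under eq_Rintegral do rewrite ReM.
  by rewrite RintegralB//; [|exact: integrableZ..]; rewrite !RintegralZl.
- under eq_Rintegral do rewrite ImM.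
  by rewrite RintegralD//; [|exact: integrableZ..]; rewrite !RintegralZl.
Qed.

Lemma cintegrable0 : cintegrable (fun=> 0).
Proof. by split; exact: integrable0. Qed.

Lemma cintegrable_sum n (u : 'I_n -> T -> R[i]) :
  (forall i, cintegrable (u i)) -> cintegrable (fun x => \sum_(i < n) u i x).
Proof.
move=> iu; elim: n => [|n IH] in u iu *.
  by under eq_fun do rewrite big_ord0; exact: cintegrable0.
under eq_fun do rewrite big_ord_recl.
by apply: cintegrableD; [exact: iu|exact: IH].
Qed.

Lemma cintegral_sum n (u : 'I_n -> T -> R[i]) :
  (forall i, cintegrable (u i)) ->
  cintegral mu D (fun x => \sum_(i < n) u i x) =
  \sum_(i < n) cintegral mu D (u i).
Proof.
move=> iu; elim: n => [|n IH] in u iu *.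
  rewrite big_ord0; under eq_cintegral do rewrite big_ord0.
  by apply: complexP; rewrite /= /Rintegral integral0.
rewrite big_ord_recl; under eq_cintegral do rewrite big_ord_recl.
rewrite cintegralD; [by congr (_ + _); exact: IH|exact: iu|].
exact: cintegrable_sum.
Qed.

Lemma cmeasurable_normc u : cmeasurable u ->
  measurable_fun D (fun x => Re `|u x|).
Proof.
move=> [ru iu]; under eq_fun do rewrite Re_normcE.
have ms : measurable_fun setT (@Num.sqrt R).
  by apply: continuous_measurable_fun; exact: sqrt_continuous.
apply: (measurableT_comp ms).
by apply: measurable_funD; exact: measurable_funX.
Qed.

End complex_integral.

(** * Cauchy-Schwarz inequality and mean square limits *)

Section square_integrable.
Context {d : measure_display} {T : measurableType d} {R : realType}.
Variables (mu : {measure set T -> \bar R}) (D : set T).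
Hypothesis mD : measurable D.
Implicit Types u v e : T -> R[i].
Local Notation Re := (@complex.Re R).
Local Notation Im := (@complex.Im R).

(** The integral is the square of the norm, so both are finite together; finiteness can then be
    proved by comparing integrals. *)
Lemma L2norm_lty u :
  (L2norm mu D u < +oo)%E <->
  (\int[mu]_(x in D) (Re `|u x| ^+ 2)%:E < +oo)%E.
Proof.
have -> : (\int[mu]_(x in D) (Re `|u x| ^+ 2)%:E =
    L2norm mu D u `^ 2)%E.
  rewrite /L2norm powR_Lnorm// integral_mkcond; apply: eq_integral => x _.
  rewrite !patchE; case: ifPn => _ /=; last by rewrite normr0 powR0.
  by rewrite powR_mulrn// real_normK// num_real.
by split=> [/poweR_lty//|/lty_poweRy]; apply.
Qed.

Lemma L2norm_ge0 u : (0 <= L2norm mu D u)%E.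
Proof. exact: Lnorm_ge0. Qed.

(** Hoelder's inequality with exponents 2 and 2 for the moduli, extended by zero outside [D]. *)
Lemma L2norm_hoelder u e : cmeasurable D u -> cmeasurable D e ->
  (\int[mu]_(x in D) (Re `|u x * e x|)%:E
     <= L2norm mu D u * L2norm mu D e)%E.
Proof.
move=> mu_ me.
have mr v : cmeasurable D v -> measurable_fun setT ((fun x => Re `|v x|) \_ D).
  by move=> mv; apply/(measurable_restrictT _ mD); exact: cmeasurable_normc.
have half2 : 2^-1 + 2^-1 = 1 :> R by rewrite [RHS]splitr !div1r.
have := @hoelder _ _ _ mu _ _ 2 2 (mr _ mu_) (mr _ me) (ltr0Sn _ _)
  (ltr0Sn _ _) half2.
rewrite -!restrict_EFin; apply: le_trans.
rewrite Lnorm1 integral_mkcond le_eqVlt; apply/orP; left; apply/eqP.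

apply: eq_integral => x _; rewrite /comp /GRing.mul_fun !patchE.
case: ifPn => _.
  by rewrite gee0_abs ?lee_fin ?mulr_ge0 ?Re_normcM// Re_normc_ge0.
by rewrite (mul0r (0 : R)) abse0.
Qed.

(** [r] stands for the real or the imaginary part, both dominated by the modulus. *)
Let le_integral_normc (r : R[i] -> R) u e :
  (forall z, `|r z| <= Re `|z|) ->
  measurable_fun D (fun x => r (u x * e x)) ->
  cmeasurable D u -> cmeasurable D e ->
  (\int[mu]_(x in D) `|(r (u x * e x))%:E|
     <= L2norm mu D u * L2norm mu D e)%E.
Proof.
move=> rle mr mu_ me; apply: le_trans (L2norm_hoelder mu_ me).
apply: ge0_le_integral => //=.
- by apply/measurable_EFinP; exact: measurableT_comp.
- by apply/measurable_EFinP/cmeasurable_normc/cmeasurableM.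
- by move=> x _; rewrite lee_fin rle.
Qed.

Lemma cintegrable_mul_L2 u e : cmeasurable D u -> cmeasurable D e ->
  (L2norm mu D u < +oo)%E -> (L2norm mu D e < +oo)%E ->
  cintegrable mu D (fun x => u x * e x).
Proof.
move=> mu_ me uoo eoo; have [mr mi] := cmeasurableM mu_ me.
have ueoo : (L2norm mu D u * L2norm mu D e < +oo)%E.
  by rewrite lte_mul_pinfty ?L2norm_ge0// ge0_fin_numE// L2norm_ge0.
split; apply/integrableP; (split; first exact/measurable_EFinP);
  apply: le_lt_trans ueoo; apply: le_integral_normc => //.
- exact: normr_Re_le.
- exact: normr_Im_le.
Qed.

(** Two real bounds take the place of one on the modulus of the integral; they are enough to show
    that a complex number is 0. *)
Lemma abs_cintegral_mul u e : cmeasurable D u -> cmeasurable D e ->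
  (`|Re (cintegral mu D (fun x => u x * e x))|%:E
     <= L2norm mu D u * L2norm mu D e)%E /\
  (`|Im (cintegral mu D (fun x => u x * e x))|%:E
     <= L2norm mu D u * L2norm mu D e)%E.
Proof.
move=> mu_ me; have [mr mi] := cmeasurableM mu_ me.
(* [fine] sends infinite values to 0, so this bound holds for every extended real. *)
have fine_abs (x : \bar R) : (`|fine x|%:E <= `|x|)%E.
  by case: x => [r||] //=; rewrite leey.
split; apply: le_trans (fine_abs _) _;
  (apply: le_trans (le_abse_integral _ mD _) _; first exact/measurable_EFinP);
  apply: le_integral_normc => //.
- exact: normr_Re_le.
- exact: normr_Im_le.
Qed.

(** Mean square convergence passes to integrals against a fixed [e]: both parts of [z] are
    eventually bounded by the norm of [w i] times that of [e], which tends to 0, while [z] does not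
    depend on [i]. *)
Lemma L2norm_cvg0_cintegral {I : Type} {F : set_system I} {FF : ProperFilter F}
    (w : I -> T -> R[i]) e (z : R[i]) :
  (forall i, cmeasurable D (w i)) -> cmeasurable D e ->
  (L2norm mu D e < +oo)%E ->
  (L2norm mu D (w i) @[i --> F] --> 0)%E ->
  (\forall i \near F, cintegral mu D (fun x => w i x * e x) = z) -> z = 0.
Proof.
move=> mw me eoo w0 wz.
have : (L2norm mu D (w i) * L2norm mu D e @[i --> F] --> 0)%E.
  rewrite -[0%E in X in _ --> X](mul0e (L2norm mu D e)).
  by apply: cvgeZr w0; rewrite ge0_fin_numE// L2norm_ge0.
move=> /cvge_to_ge we0; apply: complexP; apply/eqP; rewrite -normr_le0 -lee_fin;
  apply: we0; near=> i; rewrite -(near wz i)//.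
- by have [] := abs_cintegral_mul (mw i) me.
- by have [] := abs_cintegral_mul (mw i) me.
Unshelve. all: by end_near. Qed.

End square_integrable.

(** * Exchange of the variables in double integrals *)

Section product_integral.
Context {d1 d2 : measure_display} {T1 : measurableType d1}
  {T2 : measurableType d2} {R : realType}.
Variables (m1 : {sigma_finite_measure set T1 -> \bar R})
  (m2 : {sigma_finite_measure set T2 -> \bar R}).
Local Open Scope ereal_scope.

(** By Tonelli, integrability amounts to finiteness of an iterated integral of the absolute value,
    in either order; swapping turns one order into the other. *)
Lemma integrable_swap (f : T1 * T2 -> \bar R) :
  (m1 \x m2).-integrable setT f ->
  (m2 \x m1).-integrable setT (fun z => f (z.2, z.1)).
Proof.
move=> fi; have mf := measurable_int _ fi.
apply/integrable12ltyP.
  exact: (measurableT_comp mf (@measurable_swap _ _ T2 T1)).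
exact/(integrable21ltyP m1 m2 mf).1.
Qed.

Lemma integral_swap (f : T1 * T2 -> \bar R) :
  (m1 \x m2).-integrable setT f ->
  \int[m2 \x m1]_z f (z.2, z.1) = \int[m1 \x m2]_z f z.
Proof.
move=> fi; rewrite -(integral12_prod_meas1 (integrable_swap fi)).
by rewrite -(integral21_prod_meas1 fi).
Qed.

End product_integral.

(** * Fubini's theorem on rectangles *)

Section integral_setX.
Context {d1 d2 : measure_display} {T1 : measurableType d1}
  {T2 : measurableType d2} {R : realType}.
Variables (m1 : {sigma_finite_measure set T1 -> \bar R})
  (m2 : {sigma_finite_measure set T2 -> \bar R}).
Variables (D1 : set T1) (D2 : set T2).
Hypotheses (mD1 : measurable D1) (mD2 : measurable D2).
Local Open Scope ereal_scope.

Let mD12 : measurable (D1 `*` D2). Proof. exact: measurableX. Qed.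

Let patch_swap (f : T1 * T2 -> \bar R) :
  (fun z => f (z.2, z.1)) \_ (D2 `*` D1) =
  (fun z => (f \_ (D1 `*` D2)) (z.2, z.1)).
Proof.
apply/funext => -[y x]; rewrite /= !patchE.
by rewrite !in_setX andbC.
Qed.

Lemma integrable_setX_swap (f : T1 * T2 -> \bar R) :
  (m1 \x m2).-integrable (D1 `*` D2) f ->
  (m2 \x m1).-integrable (D2 `*` D1) (fun z => f (z.2, z.1)).
Proof.
move=> /(integrable_mkcond _ mD12)/integrable_swap fi.
by apply/(integrable_mkcond _ (measurableX mD2 mD1)); rewrite patch_swap.
Qed.

Lemma integral_setX_swap (f : T1 * T2 -> \bar R) :
  (m1 \x m2).-integrable (D1 `*` D2) f ->
  \int[m2 \x m1]_(z in D2 `*` D1) f (z.2, z.1) =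
  \int[m1 \x m2]_(z in D1 `*` D2) f z.
Proof.
move=> /(integrable_mkcond _ mD12)/integral_swap fE.
by rewrite integral_mkcond patch_swap fE -integral_mkcond.
Qed.

(** Transfers Fubini's theorem from the whole product to rectangles: extending by zero commutes with
    integrating out [y]. *)
Let fubini_F_patch (f : T1 * T2 -> \bar R) :
  fubini_F m2 (f \_ (D1 `*` D2)) =
  (fun x => \int[m2]_(y in D2) f (x, y)) \_ D1.
Proof.
apply/funext => x; rewrite /fubini_F patchE; case: ifPn => xD1.
  rewrite [RHS]integral_mkcond; apply: eq_integral => y _.
  by rewrite !patchE in_setX xD1.
by apply: integral0_eq => y _; rewrite patchE in_setX (negbTE xD1).
Qed.

Lemma integrable_setX_fst (f : T1 * T2 -> \bar R) :
  (m1 \x m2).-integrable (D1 `*` D2) f ->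
  m1.-integrable D1 (fun x => \int[m2]_(y in D2) f (x, y)).
Proof.
move=> /(integrable_mkcond _ mD12)/integrable_fubini_F.
by rewrite fubini_F_patch => /(integrable_mkcond _ mD1).
Qed.

Lemma integral_setX (f : T1 * T2 -> \bar R) :
  (m1 \x m2).-integrable (D1 `*` D2) f ->
  \int[m1 \x m2]_(z in D1 `*` D2) f z =
  \int[m1]_(x in D1) \int[m2]_(y in D2) f (x, y).
Proof.
move=> /(integrable_mkcond _ mD12)/integral12_prod_meas1 fE.
by rewrite integral_mkcond -fE fubini_F_patch -integral_mkcond.
Qed.

Lemma ae_integrable_setX (f : T1 * T2 -> \bar R) :
  (m1 \x m2).-integrable (D1 `*` D2) f ->
  {ae m1, forall x, D1 x -> m2.-integrable D2 (fun y => f (x, y))}.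
Proof.
move=> /(integrable_mkcond _ mD12)/ae_integrable1; apply: filterS => x fx D1x.
apply/(integrable_mkcond _ mD2); apply: eq_integrable fx => // y _.
by rewrite !patchE in_setX mem_set.
Qed.

(** For the zero extensions [P] and [Q], the iterated integral of the absolute value is a product of
    two finite integrals. *)
Lemma integrable_setX_tensor (p : T1 -> R) (q : T2 -> R) :
  m1.-integrable D1 (EFin \o p) -> m2.-integrable D2 (EFin \o q) ->
  (m1 \x m2).-integrable (D1 `*` D2) (fun z => (p z.1 * q z.2)%:E).
Proof.
move=> ip iq; apply/(integrable_mkcond _ mD12).
pose P := p \_ D1; pose Q := q \_ D2.
have iP : m1.-integrable setT (EFin \o P).
  by rewrite -restrict_EFin; exact/(integrable_mkcond _ mD1).
have iQ : m2.-integrable setT (EFin \o Q).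
  by rewrite -restrict_EFin; exact/(integrable_mkcond _ mD2).
have mP : measurable_fun setT P by exact/measurable_EFinP/(measurable_int _ iP).
have mQ : measurable_fun setT Q by exact/measurable_EFinP/(measurable_int _ iQ).
have -> : (fun z => (p z.1 * q z.2)%:E) \_ (D1 `*` D2) =
    (fun z => (P z.1 * Q z.2)%:E).
  apply/funext => -[x y]; rewrite /P /Q !patchE in_setX.
  by case: (x \in D1); case: (y \in D2); rewrite /= ?(mul0r, mulr0).
apply/integrable12ltyP.
  apply/measurable_EFinP; apply: measurable_funM.
  - exact: measurableT_comp mP measurable_fst.
  - exact: measurableT_comp mQ measurable_snd.
under eq_integral.
  move=> x _; under eq_integral do rewrite /= normrM EFinM.
  rewrite integralZl//; last exact: integrable_norm iQ.
  over.
have Qfin : \int[m2]_y `|Q y|%:E \is a fin_num.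
  exact: integrable_fin_num (integrable_norm iQ).
rewrite -(fineK Qfin) integralZr//; last exact: integrable_norm iP.
rewrite ltey_eq fin_numM//.
exact: integrable_fin_num (integrable_norm iP).
Qed.

End integral_setX.

(** * From test sets to test functions *)

Section integral_setX_test.
Context {d1 d2 : measure_display} {T1 : measurableType d1}
  {T2 : measurableType d2} {R : realType}.
Variables (m1 : {sigma_finite_measure set T1 -> \bar R})
  (m2 : {sigma_finite_measure set T2 -> \bar R}).
Variables (D1 : set T1) (D2 : set T2).
Hypotheses (mD1 : measurable D1) (mD2 : measurable D2).
Local Open Scope ereal_scope.

(** Integrable functions with the same integral on all measurable sets agree almost everywhere.
    Hence the inner integral of [F] is [g] up to a null set, and [a], which depends on [x] only, can
    be multiplied in afterwards. *)
Lemma integral_setX_test (F : T1 * T2 -> R) (g a : T1 -> R) :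
  (m1 \x m2).-integrable (D1 `*` D2) (EFin \o F) ->
  m1.-integrable D1 (EFin \o g) ->
  (forall A, measurable A -> A `<=` D1 ->
    \int[m1 \x m2]_(z in A `*` D2) (F z)%:E = \int[m1]_(x in A) (g x)%:E) ->
  measurable_fun D1 a ->
  (m1 \x m2).-integrable (D1 `*` D2) (fun z => (F z * a z.1)%:E) ->
  \int[m1 \x m2]_(z in D1 `*` D2) (F z * a z.1)%:E =
  \int[m1]_(x in D1) (g x * a x)%:E.
Proof.
move=> iF ig FgE ma iFa.
have iH := integrable_setX_fst mD1 mD2 iF.
have Hg : ae_eq m1 D1 (fun x => \int[m2]_(y in D2) (F (x, y))%:E) (EFin \o g).
  apply: integral_ae_eq => //; first exact: measurable_int ig.
  move=> A AD1 mA; rewrite -(FgE _ mA AD1) (integral_setX mA mD2)//.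
  apply: integrableS iF; [exact: measurableX|exact: measurableX|].
  exact: setSX.
rewrite integral_setX//; apply: ae_eq_integral => //.
- exact: measurable_int (integrable_setX_fst mD1 mD2 iFa).
- apply/measurable_EFinP; apply: measurable_funM => //.
  exact/measurable_EFinP/(measurable_int _ ig).
(* For almost every [x] the slice of [F] at [x] is integrable, so the constant [a x] leaves the
   inner integral. *)
apply: filterS2 (ae_integrable_setX mD1 mD2 iF) Hg => x iFx Hgx D1x.
rewrite /=; under eq_integral do rewrite EFinM.
by rewrite integralZr//; [rewrite (Hgx D1x) EFinM|exact: iFx].
Qed.

End integral_setX_test.

(** * Tensor products of functions of one variable *)

Section complex_tensor.
Context {d1 d2 : measure_display} {T1 : measurableType d1}
  {T2 : measurableType d2} {R : realType}.
Variables (m1 : {sigma_finite_measure set T1 -> \bar R})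
  (m2 : {sigma_finite_measure set T2 -> \bar R}).
Variables (D1 : set T1) (D2 : set T2).
Hypotheses (mD1 : measurable D1) (mD2 : measurable D2).
Local Notation Re := (@complex.Re R).
Local Notation Im := (@complex.Im R).

Definition tensor (p : T1 -> R[i]) (q : T2 -> R[i]) : T1 * T2 -> R[i] :=
  fun z => p z.1 * q z.2.

Let mD12 : measurable (D1 `*` D2). Proof. exact: measurableX. Qed.

Lemma measurable_fun_setX_fst (p : T1 -> R) : measurable_fun D1 p ->
  measurable_fun (D1 `*` D2) (fun z => p z.1).
Proof.
move=> mp; apply: (measurable_comp mD1 _ mp); last exact: measurable_funTS.
by move=> _ [z [Dz _] <-].
Qed.

Lemma measurable_fun_setX_snd (q : T2 -> R) : measurable_fun D2 q ->
  measurable_fun (D1 `*` D2) (fun z => q z.2).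
Proof.
move=> mq; apply: (measurable_comp mD2 _ mq); last exact: measurable_funTS.
by move=> _ [z [_ Dz] <-].
Qed.

Lemma cmeasurable_tensor p q : cmeasurable D1 p -> cmeasurable D2 q ->
  cmeasurable (D1 `*` D2) (tensor p q).
Proof.
move=> [rp ip] [rq iq]; apply: cmeasurableM; split => /=.
- exact: measurable_fun_setX_fst rp.
- exact: measurable_fun_setX_fst ip.
- exact: measurable_fun_setX_snd rq.
- exact: measurable_fun_setX_snd iq.
Qed.

Lemma cintegrable_tensor p q : cintegrable m1 D1 p -> cintegrable m2 D2 q ->
  cintegrable (m1 \x m2)%E (D1 `*` D2) (tensor p q).
Proof.
move=> [rp ip] [rq iq]; split.
- under eq_fun do rewrite ReM EFinB.
  apply: integrableB => //.
  + exact: (integrable_setX_tensor mD1 mD2 rp rq).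
  + exact: (integrable_setX_tensor mD1 mD2 ip iq).
- under eq_fun do rewrite ImM EFinD.
  apply: integrableD => //.
  + exact: (integrable_setX_tensor mD1 mD2 rp iq).
  + exact: (integrable_setX_tensor mD1 mD2 ip rq).
Qed.

Let Rintegral_tensor (p : T1 -> R) (q : T2 -> R) :
  m1.-integrable D1 (EFin \o p) -> m2.-integrable D2 (EFin \o q) ->
  \int[(m1 \x m2)%E]_(z in D1 `*` D2) (p z.1 * q z.2) =
  \int[m1]_(x in D1) p x * \int[m2]_(y in D2) q y.
Proof.
move=> ip iq; rewrite /Rintegral integral_setX//; last first.
  exact: integrable_setX_tensor.
rewrite -fineM ?integrable_fin_num//; congr fine.
rewrite -(fineK (integrable_fin_num mD2 iq)) -integralZr//.
apply: eq_integral => x _ /=; under eq_integral do rewrite EFinM.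
by rewrite integralZl// fineK// integrable_fin_num.
Qed.

Lemma cintegral_tensor p q : cintegrable m1 D1 p -> cintegrable m2 D2 q ->
  cintegral (m1 \x m2)%E (D1 `*` D2) (tensor p q) =
  cintegral m1 D1 p * cintegral m2 D2 q.
Proof.
move=> [rp ip] [rq iq]; apply: complexP; rewrite ?ReM ?ImM /=.
- transitivity (\int[(m1 \x m2)%E]_(z in D1 `*` D2)
    (Re (p z.1) * Re (q z.2) - Im (p z.1) * Im (q z.2))).
    by apply: eq_Rintegral => z _; rewrite ReM.
  rewrite RintegralB//; last 2 first.
  + exact: (integrable_setX_tensor mD1 mD2 rp rq).
  + exact: (integrable_setX_tensor mD1 mD2 ip iq).
  by rewrite (Rintegral_tensor rp rq) (Rintegral_tensor ip iq).
- transitivity (\int[(m1 \x m2)%E]_(z in D1 `*` D2)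
    (Re (p z.1) * Im (q z.2) + Im (p z.1) * Re (q z.2))).
    by apply: eq_Rintegral => z _; rewrite ImM.
  rewrite RintegralD//; last 2 first.
  + exact: (integrable_setX_tensor mD1 mD2 rp iq).
  + exact: (integrable_setX_tensor mD1 mD2 ip rq).
  by rewrite (Rintegral_tensor rp iq) (Rintegral_tensor ip rq).
Qed.

(** The squared modulus of a tensor product is the tensor product of the squared moduli, both
    integrable. *)
Lemma L2norm_tensor_lty p q : cmeasurable D1 p -> cmeasurable D2 q ->
  (L2norm m1 D1 p < +oo)%E -> (L2norm m2 D2 q < +oo)%E ->
  (L2norm (m1 \x m2)%E (D1 `*` D2) (tensor p q) < +oo)%E.
Proof.
move=> mp mq /L2norm_lty poo /L2norm_lty qoo; apply/L2norm_lty.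
have isq d (T : measurableType d) (m : {measure set T -> \bar R}) D
    (u : T -> R[i]) : cmeasurable D u ->
    (\int[m]_(x in D) (Re `|u x| ^+ 2)%:E < +oo)%E ->
    m.-integrable D (EFin \o (fun x => Re `|u x| ^+ 2)).
  move=> mu uoo; apply/integrableP; split.
    by apply/measurable_EFinP/measurable_funX; exact: cmeasurable_normc.
  by under eq_integral do rewrite gee0_abs ?lee_fin ?sqr_ge0//.
under eq_integral do rewrite /tensor Re_normcM exprMn.
apply: integrable_lty => //.
exact: (integrable_setX_tensor mD1 mD2 (isq _ _ _ _ _ mp poo)
  (isq _ _ _ _ _ mq qoo)).
Qed.

End complex_tensor.

(** * Mean square expansions tested against tensor products *)

Section expansion.
Local Notation Re := (@complex.Re _).
Local Notation Im := (@complex.Im _).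
Context {d : measure_display} {T : measurableType d} {R : realType}.
Variables (m : {sigma_finite_measure set T -> \bar R}) (D : set T).
Hypothesis mD : measurable D.
Variables (phi : nat -> T -> R[i]) (c : nat -> nat -> R[i]) (f : T * T -> R).
Hypothesis mphi : forall k, cmeasurable D (phi k).
Hypothesis phioo : forall k, (L2norm m D (phi k) < +oo)%E.
Hypothesis mf : measurable_fun (D `*` D) f.
Hypothesis f_expansion : L2norm (m \x m)%E (D `*` D)
    (fun z => (f z)%:C -
       \sum_(j < N.1) \sum_(k < N.2) c j k * (phi j z.1 * phi k z.2))
    @[N --> filter_prod \oo \oo] --> 0%E.

Let mDD : measurable (D `*` D). Proof. exact: measurableX. Qed.

Let partial_sum (N : nat * nat) (z : T * T) : R[i] :=
  \sum_(j < N.1) \sum_(k < N.2) c j k * (phi j z.1 * phi k z.2).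

Section test_function.
Variables a b : T -> R[i].
Hypotheses (ma : cmeasurable D a) (mb : cmeasurable D b).
Hypotheses (aoo : (L2norm m D a < +oo)%E) (boo : (L2norm m D b < +oo)%E).

Let ia j : cintegrable m D (fun x => phi j x * a x).
Proof. exact: (cintegrable_mul_L2 mD (mphi j) ma (phioo j) aoo). Qed.

Let ib k : cintegrable m D (fun x => phi k x * b x).
Proof. exact: (cintegrable_mul_L2 mD (mphi k) mb (phioo k) boo). Qed.

Let partial_sum_tensor N z : partial_sum N z * tensor a b z =
  \sum_(j < N.1) \sum_(k < N.2)
    c j k * tensor (fun x => phi j x * a x) (fun y => phi k y * b y) z.
Proof.
rewrite mulr_suml; apply: eq_bigr => j _; rewrite mulr_suml.
by apply: eq_bigr => k _; rewrite -mulrA /tensor mulrACA.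
Qed.

Let iterm j k : cintegrable (m \x m)%E (D `*` D) (fun z => c j k *
  tensor (fun x => phi j x * a x) (fun y => phi k y * b y) z).
Proof. by apply: cintegrableZl => //; exact: cintegrable_tensor. Qed.

Let ipartial_sum N :
  cintegrable (m \x m)%E (D `*` D) (fun z => partial_sum N z * tensor a b z).
Proof.
under eq_fun do rewrite partial_sum_tensor.
by apply: cintegrable_sum => // j; apply: cintegrable_sum => // k; exact: iterm.
Qed.

Let cintegral_partial_sum N :
  cintegral (m \x m)%E (D `*` D) (fun z => partial_sum N z * tensor a b z) =
  \sum_(j < N.1) \sum_(k < N.2)
    c j k * (cintegral m D (fun x => phi j x * a x) *
             cintegral m D (fun y => phi k y * b y)).
Proof.
under eq_cintegral do rewrite partial_sum_tensor.
rewrite cintegral_sum//; last first.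
  by move=> j; apply: cintegrable_sum => // k; exact: iterm.
apply: eq_bigr => j _; rewrite cintegral_sum//.
by apply: eq_bigr => k _; rewrite cintegralZl ?cintegral_tensor//;
  exact: cintegrable_tensor.
Qed.

Let mresidual N : cmeasurable (D `*` D) (fun z => (f z)%:C - partial_sum N z).
Proof.
apply: cmeasurableD; first by split; [exact: mf|exact: measurable_cst].
apply: cmeasurableN; apply: cmeasurable_sum => j; apply: cmeasurable_sum => k.
by apply: cmeasurableM; [exact: cmeasurable_cst|exact: cmeasurable_tensor].
Qed.

Let mtensor : cmeasurable (D `*` D) (tensor a b).
Proof. exact: cmeasurable_tensor. Qed.

Let tensoroo : (L2norm (m \x m)%E (D `*` D) (tensor a b) < +oo)%E.
Proof. exact: L2norm_tensor_lty. Qed.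

(** [f] is split into a residual of finite norm, integrable against the tensor product by
    Cauchy-Schwarz, and a partial sum, whose terms become tensor products of integrable
    functions. *)
Lemma cintegrable_expansion :
  cintegrable (m \x m)%E (D `*` D) (fun z => (f z)%:C * tensor a b z).
Proof.
(* A norm that tends to 0 is eventually finite, so some cut-offs [N] give a residual of finite
   norm. *)
have [/filter_ex[N Nfin] _] := (fine_cvgP _ _).1 f_expansion.
apply: (@eq_cintegrable _ _ _ _ _ mDD (fun z =>
  ((f z)%:C - partial_sum N z) * tensor a b z +
  partial_sum N z * tensor a b z)).
  by move=> z _; rewrite -mulrDl subrK.
apply: cintegrableD => //; apply: cintegrable_mul_L2 => //.
by rewrite ltey_eq Nfin.
Qed.

(** The integral of [f] minus that of a partial sum is the integral of the residual, to which the
    mean square limit applies. In every use the sums are eventually constant, so [s] replaces the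
    sum of a double series. *)
Lemma cintegral_expansion (s : R[i]) :
  (\forall N \near filter_prod \oo \oo,
    \sum_(j < N.1) \sum_(k < N.2)
      c j k * (cintegral m D (fun x => phi j x * a x) *
               cintegral m D (fun y => phi k y * b y)) = s) ->
  cintegral (m \x m)%E (D `*` D) (fun z => (f z)%:C * tensor a b z) = s.
Proof.
move=> sE; apply/eqP; rewrite -subr_eq0; apply/eqP.
apply: (L2norm_cvg0_cintegral mDD mresidual mtensor tensoroo f_expansion).
apply: filterS sE => N /= <-; rewrite -cintegral_partial_sum.
rewrite -[X in _ - X]mul1r -mulNr -cintegralZl// -cintegralD//; last 2 first.
- exact: cintegrable_expansion.
- exact: cintegrableZl.
by apply: eq_cintegral => z _; rewrite mulrBl mulN1r.
Qed.

End test_function.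

(** * Coefficients of the expansion and independence *)

Hypothesis phi_orthonormal : orthonormal_family m D phi.
Hypothesis phi0 : forall x, D x -> phi 0%N x = 1.
Hypothesis mD1 : m D = 1%E.

Let mDfin (A : set T) : measurable A -> A `<=` D -> m A \is a fin_num.
Proof.
move=> mA AD; rewrite ge0_fin_numE// (@le_lt_trans _ _ (m D))//.
  by apply: le_measure => //; rewrite inE.
by rewrite mD1 ltry.
Qed.

Let cmeasurable_conj k : cmeasurable D (fun x => (phi k x)^*).
Proof.
split; first by under eq_fun do rewrite ReJ; exact: (mphi k).1.
under eq_fun do rewrite ImJ.
by apply: measurableT_comp => //; exact: (mphi k).2.
Qed.

Let L2norm_conj k : (L2norm m D (fun x => ((phi k x)^*)%C) < +oo)%E.
Proof.
apply/L2norm_lty; move/L2norm_lty: (phioo k).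
rewrite (eq_integral (fun x => (Re `|(phi k x)^*%C| ^+ 2)%:E))// => x _.
by rewrite !Re_normc_sqr ReJ ImJ sqrrN.
Qed.

(** Conjugates as test functions turn the one-variable integrals into inner products. Once the
    cut-offs exceed [p] and [q], orthonormality leaves a single term. *)
Lemma coefficientE p q : c p q =
  cintegral (m \x m)%E (D `*` D)
    (fun z => (f z)%:C *
       tensor (fun x => (phi p x)^*) (fun y => (phi q y)^*) z).
Proof.
symmetry; apply: cintegral_expansion => //.
(* The inequalities are strict because the cut-off itself is not summed over. *)
exists ([set n | (p < n)%N], [set n | (q < n)%N]).
  by split; exact: nbhs_infty_gt.
move=> [N1 N2] [/= pN1 qN2].
rewrite (bigD1 (Ordinal pN1))//= (bigD1 (Ordinal qN2))//=.
rewrite [X in X + _ = _](_ : _ = c p q); last first.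
  rewrite -/(inner m D (phi p) (phi p)) -/(inner m D (phi q) (phi q)).
  rewrite !phi_orthonormal !eqxx !mulr1 big1 ?addr0// => k kq.
  rewrite -/(inner m D (phi k) (phi q)) phi_orthonormal.
  rewrite (_ : (val k == q) = false) ?mulr0//.
  by apply/negbTE; apply: contra_neq kq => kq; exact: val_inj.
rewrite big1 ?addr0// => j jp; rewrite big1// => k _.
rewrite -/(inner m D (phi j) (phi p)) phi_orthonormal.
rewrite (_ : (val j == p) = false) ?mul0r ?mulr0//.
by apply/negbTE; apply: contra_neq jp => jp; exact: val_inj.
Qed.

(** Independence involves real test functions; they are embedded in [R[i]] so that the complex
    results above apply. *)
Let rL2 (a : T -> R) :=
  measurable_fun D a /\ (L2norm m D (fun x => (a x)%:C) < +oo)%E.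

Let cmeasurable_real (a : T -> R) : measurable_fun D a ->
  cmeasurable D (fun x => (a x)%:C).
Proof. by split => //; exact: measurable_cst. Qed.

(** Meant for [r] the real or the imaginary part, whose square is at most the squared modulus. *)
Let rL2_part (r : R[i] -> R) (u : T -> R[i]) :
  (forall z, `|r z| <= Re `|z|) -> measurable_fun D (fun x => r (u x)) ->
  cmeasurable D u -> (L2norm m D u < +oo)%E -> rL2 (fun x => r (u x)).
Proof.
move=> rle mr mu uoo; split => //; apply/L2norm_lty; move/L2norm_lty: uoo.
apply: le_lt_trans; apply: ge0_le_integral => //.
- by move=> x _; rewrite lee_fin sqr_ge0.
- apply/measurable_EFinP/measurable_funX.
  exact/cmeasurable_normc/cmeasurable_real.
- exact/measurable_EFinP/measurable_funX/cmeasurable_normc.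
move=> x _; rewrite lee_fin [leLHS]Re_normc_sqr /= expr0n addr0.
rewrite -real_normK ?num_real//.
by rewrite lerXn2r// nnegrE ?Re_normc_ge0.
Qed.

(** The square is at most [M ^+ 2] on a set of measure 1. *)
Let rL2_bounded (a : T -> R) (M : R) : measurable_fun D a ->
  (forall x, D x -> `|a x| <= M) -> rL2 a.
Proof.
move=> ma aM; split => //; apply/L2norm_lty.
apply: (@le_lt_trans _ _ (\int[m]_(x in D) (M ^+ 2)%:E)%E).
  apply: ge0_le_integral => //.
  - by move=> x _; rewrite lee_fin sqr_ge0.
  - apply/measurable_EFinP/measurable_funX.
    exact/cmeasurable_normc/cmeasurable_real.
  move=> x Dx; rewrite lee_fin [leLHS]Re_normc_sqr /= expr0n addr0.
  rewrite -real_normK ?num_real// lerXn2r// ?nnegrE ?aM//.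
  exact: le_trans (aM _ Dx).
by rewrite integral_cst// [X in (_ * X)%E]mD1 mule1 ltry.
Qed.

Let integrable_test (a b : T -> R) : rL2 a -> rL2 b ->
  (m \x m)%E.-integrable (D `*` D) (fun z => (f z * (a z.1 * b z.2))%:E).
Proof.
move=> [ma aoo] [mb boo].
have [+ _] := cintegrable_expansion (cmeasurable_real ma)
  (cmeasurable_real mb) aoo boo.
by apply: eq_integrable => // z _; rewrite /tensor -!rmorphM.
Qed.

Let rL2_cst (r : R) : rL2 (fun=> r).
Proof. by apply: (rL2_bounded (M := `|r|)). Qed.

Let integrable_density : (m \x m)%E.-integrable (D `*` D) (EFin \o f).
Proof.
have := integrable_test (rL2_cst 1) (rL2_cst 1).
by apply: eq_integrable => // z _; rewrite /= !mulr1.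
Qed.

(** Both test functions are 1 on [D]. For a probability density the value is 1, which excludes the
    zero matrix. *)
Lemma coefficient00E :
  c 0%N 0%N = (fine (\int[m \x m]_(z in D `*` D) (f z)%:E)%E)%:C.
Proof.
rewrite coefficientE; transitivity
  (cintegral (m \x m)%E (D `*` D) (fun z => (f z)%:C)).
  apply: eq_cintegral => -[x y] [/= Dx Dy].
  by rewrite /tensor /= !phi0// conjc1 !mulr1.
by apply: complexP => //=; rewrite /Rintegral integral0.
Qed.

(** Independence read off the density, when the second marginal is [m] on [D]: the integral over A x
    D is the probability that the first variable is in [A], and [m B] that the second is in [B]. *)
Definition independent_density := forall A B : set T,
  measurable A -> measurable B -> A `<=` D -> B `<=` D ->
  (\int[m \x m]_(z in A `*` B) (f z)%:E =
   \int[m \x m]_(z in A `*` D) (f z)%:E * m B)%E.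

Let Rintegral_indicX (A B : set T) :
  measurable A -> measurable B -> A `<=` D -> B `<=` D ->
  \int[(m \x m)%E]_(z in D `*` D) (f z * (\1_A z.1 * \1_B z.2)) =
  \int[(m \x m)%E]_(z in A `*` B) f z.
Proof.
move=> mA mB AD BD; rewrite -[in RHS](setIidr (setSX BD AD)).
rewrite [RHS]Rintegral_mkcondr; apply: eq_Rintegral => -[x y] _.
rewrite patchE in_setX !indicE /=.
by case: (x \in A); case: (y \in B); rewrite /= ?(mulr1, mulr0, mul0r).
Qed.

Let rL2_indic (A : set T) (r : R) : measurable A ->
  rL2 (fun x => \1_A x - r).
Proof.
move=> mA; apply: (rL2_bounded (M := 1 + `|r|)).
  by apply: measurable_funB => //; exact: measurable_indic.
move=> x _; apply: (le_trans (ler_normB _ _)); rewrite lerD2r.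
by rewrite indicE; case: (x \in A); rewrite ?(normr0, normr1).
Qed.

(** Cauchy-Schwarz against the constant 1, square-integrable because [D] has measure 1. *)
Let integrable_rL2 (b : T -> R) : rL2 b -> m.-integrable D (EFin \o b).
Proof.
move=> [mb boo].
have [_ ioo] := rL2_cst 1.
have [+ _] := cintegrable_mul_L2 mD (cmeasurable_real mb)
  (cmeasurable_cst D 1) boo ioo.
by apply: eq_integrable => // x _; rewrite mulr1.
Qed.

Lemma independent_density_of_coefficients :
  (forall j k, k != 0%N -> c j k = 0) -> independent_density.
Proof.
move=> c0 A B mA mB AD BD; set beta := fine (m B).
have mBE : m B = beta%:E by rewrite fineK// mDfin.
have rL2_indic0 C : measurable C -> rL2 (fun x => \1_C x).
  by move/(rL2_indic 0); under eq_fun do rewrite subr0.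
have rA := rL2_indic0 _ mA; have rB := rL2_indic0 _ mB.
have [mb boo] := rL2_indic beta mB.
have [ma aoo] := rA.
(* The terms with [k != 0] vanish by hypothesis. Those with [k = 0] contain this integral, which is
   [m B - beta * m D] with [m D = 1]. *)
have b0 : cintegral m D (fun y => phi 0%N y * (\1_B y - beta)%:C) = 0.
  transitivity (cintegral m D (fun y => (\1_B y - beta)%:C)).
    by apply: eq_cintegral => y Dy; rewrite phi0// mul1r.
  apply: complexP => /=; last by rewrite /Rintegral integral0.
  rewrite RintegralB//; last 2 first.
  - exact: integrable_rL2.
  - exact: integrable_rL2 (rL2_cst _).
  rewrite Rintegral_cst// [X in fine X]mD1 mulr1 /Rintegral integral_indic//.
  by rewrite (setIidl BD) subrr.
have /(congr1 (@complex.Re _)) : cintegral (m \x m)%E (D `*` D)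
    (fun z => (f z)%:C *
      tensor (fun x => (\1_A x)%:C) (fun y => (\1_B y - beta)%:C) z) = 0.
  apply: cintegral_expansion => //; [exact: cmeasurable_real..|].
  apply: nearW => N; rewrite big1// => j _; rewrite big1// => k _.
  have [->|k0] := eqVneq (val k) 0%N; first by rewrite b0 !mulr0.
  by rewrite c0// mul0r.
have XAB (C : set T) : measurable C -> C `<=` D ->
    measurable (A `*` C) /\ A `*` C `<=` D `*` D.
  by move=> mC CD; split; [exact: measurableX|exact: setSX].
have iX (C : set T) : measurable C -> C `<=` D ->
    (m \x m)%E.-integrable (A `*` C) (EFin \o f).
  move=> mC CD; have [mAC ACD] := XAB _ mC CD.
  exact: integrableS integrable_density.
have [mAB _] := XAB _ mB BD; have [mAD _] := XAB _ mD (@subset_refl _ D).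
(* On [D] the constant [beta] is [beta * \1_D], so the test function is a combination of two
   products of indicators. *)
have -> : Re (cintegral (m \x m)%E (D `*` D) (fun z => (f z)%:C *
      tensor (fun x => (\1_A x)%:C) (fun y => (\1_B y - beta)%:C) z)) =
    \int[(m \x m)%E]_(z in A `*` B) f z -
    beta * \int[(m \x m)%E]_(z in A `*` D) f z.
  rewrite -!Rintegral_indicX// -RintegralZl//; last first.
    exact: (integrable_test rA (rL2_indic0 _ mD)).
  rewrite -RintegralB//; last 2 first.
  - exact: (integrable_test rA rB).
  - exact: (integrableZl mDD beta (integrable_test rA (rL2_indic0 _ mD))).
  apply: eq_Rintegral => -[x y] /set_mem[_ /= Dy].
  by rewrite /tensor -!rmorphM /= !indicE (mem_set Dy) /=; ring.
move=> /eqP; rewrite subr_eq0 => /eqP fAB.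
rewrite -(fineK (integrable_fin_num mAB (iX _ mB BD))).
rewrite -/(Rintegral _ _ f) fAB mBE EFinM muleC fineK//.
exact: (integrable_fin_num mAD (iX _ mD _)).
Qed.

(** [integral_setX_test] is applied twice: in [y], to pass from sets [B] to the function [b], then
    in [x], to pass from sets [A] to the function [a]. *)
Let integral_test0 (a b : T -> R) : independent_density -> rL2 a -> rL2 b ->
  \int[m]_(y in D) b y = 0 ->
  \int[(m \x m)%E]_(z in D `*` D) (f z * (a z.1 * b z.2)) = 0.
Proof.
move=> fI ra rb b0.
have ib := integrable_rL2 rb.
have ifb : (m \x m)%E.-integrable (D `*` D) (fun z => (f z * b z.2)%:E).
  have := integrable_test (rL2_cst 1) rb.
  by apply: eq_integrable => // z _; rewrite mul1r.
have fb0 A : measurable A -> A `<=` D ->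
    (\int[m \x m]_(z in A `*` D) (f z * b z.2)%:E = 0)%E.
  move=> mA AD; have AXD : A `*` D `<=` D `*` D by exact: setSX.
  have mAD : measurable (A `*` D) by exact: measurableX.
  have ifA := integrableS mDD mAD AXD integrable_density.
  have ifbA := integrableS mDD mAD AXD ifb.
  pose k := fine (\int[m \x m]_(z in A `*` D) (f z)%:E)%E.
  have kE : (\int[m \x m]_(z in A `*` D) (f z)%:E = k%:E)%E.
    by rewrite fineK// integrable_fin_num.
  (* The test function must depend on the first variable, so [y] is put first. For fixed [A],
     independence gives the mass [k * m B] to each [B], that is, the constant density [k]. *)
  rewrite -(integral_setX_swap mA mD ifbA) /=.
  rewrite (@integral_setX_test _ _ _ _ _ _ _ _ _ mD mA
    (fun z => f (z.2, z.1)) (fun=> k) b).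
  - apply: etrans (integralZl mD ib k) _.
    rewrite -[X in (_ * X)%E](fineK (integrable_fin_num mD ib)).
    by rewrite -/(Rintegral m D b) b0 mule0.
  - exact: (integrable_setX_swap mA mD ifA).
  - exact: (integrable_rL2 (rL2_cst _)).
  - move=> B mB BD.
    rewrite (integral_setX_swap mA mB (f := EFin \o f)); last first.
      apply: integrableS integrable_density => //; first exact: measurableX.
      exact: setSX.
    by rewrite /= fI// integral_cst// kE.
  - exact: rb.1.
  - exact: (integrable_setX_swap mA mD ifbA).
rewrite /Rintegral; under eq_integral do rewrite mulrCA mulrC.
(* By [fb0], integrating [f * b] over [y] leaves a function of [x] with density 0. *)
rewrite (@integral_setX_test _ _ _ _ _ _ _ _ _ mD mD
    (fun z => f z * b z.2) (fun=> 0) a)//.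
- by under eq_integral do rewrite mul0r; rewrite integral0.
- exact: (integrable_rL2 (rL2_cst _)).
- by move=> A mA AD; rewrite fb0// integral0.
- exact: ra.1.
- apply: eq_integrable (integrable_test ra rb) => // z _.
  by rewrite mulrCA mulrC.
Qed.

(** [integral_test0] concerns real functions, so the product of the two conjugates is split into
    four real products; their factors in [y] all have mean 0. *)
Lemma coefficients_of_independent_density : independent_density ->
  forall j k, k != 0%N -> c j k = 0.
Proof.
move=> fI p q q0; rewrite coefficientE.
have q_mean0 : cintegral m D (fun y => (phi q y)^*) = 0.
  transitivity (inner m D (phi 0%N) (phi q)).
    by apply: eq_cintegral => y Dy; rewrite phi0// mul1r.
  by rewrite phi_orthonormal eq_sym (negbTE q0).
have [uR uI] : rL2 (fun x => Re (phi p x)^*%C) /\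
    rL2 (fun x => Im (phi p x)^*%C).
  have [mr mi] := cmeasurable_conj p.
  by split; apply: rL2_part => //; [exact: normr_Re_le|exact: normr_Im_le].
have [vR vI] : rL2 (fun x => Re (phi q x)^*%C) /\
    rL2 (fun x => Im (phi q x)^*%C).
  have [mr mi] := cmeasurable_conj q.
  by split; apply: rL2_part => //; [exact: normr_Re_le|exact: normr_Im_le].
have vR0 : \int[m]_(y in D) Re (phi q y)^*%C = 0.
  exact: (congr1 (@complex.Re _) q_mean0).
have vI0 : \int[m]_(y in D) Im (phi q y)^*%C = 0.
  exact: (congr1 (@complex.Im _) q_mean0).
(* [s] is -1 for the real part of the product and 1 for its imaginary part. *)
have expand (a b a' b' : T -> R) (s : R) :
    rL2 a -> rL2 b -> rL2 a' -> rL2 b' ->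
    \int[m]_(y in D) b y = 0 -> \int[m]_(y in D) b' y = 0 ->
    \int[(m \x m)%E]_(z in D `*` D)
      (f z * (a z.1 * b z.2) + s * (f z * (a' z.1 * b' z.2))) = 0.
  move=> ra rb ra' rb' b0 b'0.
  have i' := integrable_test ra' rb'.
  rewrite RintegralD//; last 2 first.
  - exact: (integrable_test ra rb).
  - exact: (integrableZl mDD s i').
  by rewrite RintegralZl// !integral_test0// mulr0 addr0.
apply: complexP => /=.
- rewrite -(expand _ _ _ _ (-1) uR vR uI vI vR0 vI0).
  apply: eq_Rintegral => z _.
  by rewrite ReM /= mul0r subr0 /tensor ReM mulrBr mulN1r.
- rewrite -(expand _ _ _ _ 1 uR vI uI vR vI0 vR0).
  apply: eq_Rintegral => z _.
  by rewrite ImM /= mul0r addr0 /tensor ImM mulrDr mul1r.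
Qed.

End expansion.

(** On a set of measure 1 this norm is 1, so that the normalization of [phi 0] reads [phi 0 = 1]. *)
Lemma L2norm_cst1 {d : measure_display} {T : measurableType d} {R : realType}
    (mu : {measure set T -> \bar R}) (D : set T) : measurable D ->
  L2norm mu D (fun=> 1) = (mu D `^ 2^-1)%E.
Proof.
move=> mD; rewrite /L2norm unlock; congr (_ `^ _)%E.
rewrite -[RHS]mul1e -integral_cst// [RHS]integral_mkcond.
apply: eq_integral => x _; rewrite !patchE; case: ifPn => _ /=.
  by rewrite expr0n expr1n addr0 sqrtr1 normr1 powR1.
by rewrite normr0 powR0.
Qed.

(** * From random variables to their joint density *)

Section uniform_pair.
Context {d : measure_display} {T : measurableType d} {R : realType}.
Variables (P : probability T R) (X Y : {RV P >-> R}) (f : R * R -> R).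
Local Notation I01 := (unit_interval R).
Local Notation lam := (@lebesgue_measure R).
Hypotheses (f_density : joint_density X Y f) (Y_uniform : uniform01 Y).

Lemma lebesgue_unit_interval : lam I01 = 1%E.
Proof.
by rewrite /unit_interval lebesgue_measure_itv/= lte_fin ltr01 sube0.
Qed.

Lemma measurable_unit_interval : measurable I01.
Proof. by rewrite /unit_interval; exact: measurable_itv. Qed.

Lemma uniform01E (B : set R) : measurable B ->
  P (Y @^-1` B) = lam (B `&` I01).
Proof.
move=> mB; rewrite -[LHS]/(distribution P Y B) Y_uniform//.
rewrite /uniform_prob integral_uniform_pdf.
have mBI : measurable (B `&` I01).
  by apply: measurableI => //; exact: measurable_unit_interval.
rewrite -[RHS]mul1e -integral_cst//; apply: eq_integral => x /set_mem[_].
by rewrite /= in_itv/= /uniform_pdf => ->; rewrite subr0 invr1.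
Qed.

Lemma joint_densityE (A B : set R) : measurable A -> measurable B ->
  P (X @^-1` A `&` Y @^-1` B) =
  (\int[lam \x lam]_(z in (A `&` I01) `*` (B `&` I01)) (f z)%:E)%E.
Proof.
move=> mA mB; have [_ _ fE] := f_density.
have := fE _ (measurableX mA mB); rewrite -setXI => <-.
by [].
Qed.

(** The density lives on the unit square, so Borel sets of the line matter only through their traces
    on the unit interval. *)
Lemma independent_RV_density :
  independent_RV X Y <-> independent_density lam I01 f.
Proof.
(* The law of [X] is the case where [B] is the whole line. *)
have PX A : measurable A -> P (X @^-1` A) =
    (\int[lam \x lam]_(z in (A `&` I01) `*` I01) (f z)%:E)%E.
  move=> mA; have := joint_densityE mA measurableT.
  by rewrite preimage_setT setIT setTI.
split=> XY A B mA mB.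
- move=> AI BI; have := XY _ _ mA mB.
  by rewrite joint_densityE// PX// uniform01E// !setIidl.
- rewrite joint_densityE// PX// uniform01E// XY//.
  + by apply: measurableI => //; exact: measurable_unit_interval.
  + by apply: measurableI => //; exact: measurable_unit_interval.
Qed.

Lemma integral_joint_density : (forall w, I01 (X w)) -> (forall w, I01 (Y w)) ->
  (\int[lam \x lam]_(z in unit_square R) (f z)%:E = 1)%E.
Proof.
move=> X01 Y01; have [_ _ fE] := f_density.
have := fE _ measurableT; rewrite setTI => <-.
by rewrite -(probability_setT P); congr (P _); apply/seteqP.
Qed.

End uniform_pair.

Theorem theorem3p2 (R : realType) (K : scalar_kind) (phi : nat -> R -> R[i])
    (phi_basis : complete_orthonormal_basis lebesgue_measure (unit_interval R)
                   K phi)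
    (phi0 : forall x, unit_interval R x ->
       phi 0%N x =
       ((fine (L2norm lebesgue_measure (unit_interval R) (fun=> 1)))^-1)%:C)
    (d : measure_display) (T : measurableType d) (P : probability T R)
    (X Y : {RV P >-> R})
    (X01 : forall w, unit_interval R (X w))
    (Y01 : forall w, unit_interval R (Y w))
    (f : R * R -> R) (f_density : joint_density X Y f)
    (c : nat -> nat -> R[i]) (c_scalar : forall j k, scalars R K (c j k))
    (f_expansion : has_expansion f c phi)
    (Y_uniform : uniform01 Y) :
  (independent_RV X Y <->
     has_rank c 1 /\
     exists h : nat -> R[i],
       (forall j, scalars R K (h j)) /\ c = outer h first_unit_vector) /\
  (independent_RV X Y <-> forall j k, k != 0%N -> c j k = 0).
Proof.
have [phi_L2 phi_on _] := phi_basis.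
(* [lebesgue_measure] lives on [measurableTypeR R], whose display is not that of
   the canonical measurable structure of [R]; the sigma-algebras coincide up to
   conversion. *)
have mI : @measurable _ (measurableTypeR R) (unit_interval R) :=
  @measurable_unit_interval R.
have I1 := @lebesgue_unit_interval R.
have mphi k : @cmeasurable _ (measurableTypeR R) R (unit_interval R) (phi k).
  by have [_ mr mi _] := phi_L2 k; split.
have phioo k : (L2norm lebesgue_measure (unit_interval R) (phi k) < +oo)%E.
  by have [] := phi_L2 k.
have phi01 x : unit_interval R x -> phi 0%N x = 1.
  by move/phi0 ->; rewrite L2norm_cst1// [X in (X `^ _)%E]I1 poweR1r invr1.
have [mf _ _] := f_density.
have indepE : independent_RV X Y <-> forall j k, k != 0%N -> c j k = 0.
  split=> [/(independent_RV_density f_density Y_uniform)|c0].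
    exact: (coefficients_of_independent_density mI mphi phioo mf f_expansion
      phi_on phi01 I1).
  apply/(independent_RV_density f_density Y_uniform).
  exact: (independent_density_of_coefficients mI mphi phioo mf f_expansion
    phi01 I1).
have c00 : c 0%N 0%N = 1.
  rewrite (coefficient00E mI mphi phioo mf f_expansion phi_on phi01).
  by rewrite (integral_joint_density f_density).
split=> //; split=> [/indepE c0|[_ [h [_ ch]]]]; last first.
  apply/indepE => j k k0.
  by rewrite ch /outer /first_unit_vector (negbTE k0) mulr0.
(* Column 0 serves as [h], and all other columns are zero. *)
have cE j k : c j k = c j 0%N * (k == 0%N)%:R.
  by have [->|k0] := eqVneq k 0%N; rewrite ?mulr1// c0// mulr0.
split; last first.
  exists (fun j => c j 0%N); split=> [j|]; first exact: c_scalar.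
  by apply/funext => j; apply/funext => k; exact: cE.
(* Column 0 is the basis of the column space; its entry 1 in row 0 makes it linearly independent. *)
exists (fun=> 0%N); split=> [a /(_ 0%N)|k].
  by rewrite big_ord1 c00 mulr1 => a0 i; rewrite ord1.
exists (fun=> (k == 0%N)%:R) => j.
by rewrite big_ord1 mulrC -cE.
Qed.
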